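(* Let $\mathfrak{B}$ be a bornology on a metric space $X$ with a closed base and let $\mathcal{I}$ be an ideal on $\omega$. If $\mathcal{I}$ has a pseudounion, then every $\mathcal{I}$-$\gamma_{\mathfrak{B}^s}$-cover of $X$ has a subset which is a $\gamma_{\mathfrak{B}^s}$-cover of $X$.
   Context: $(X,d)$ is an infinite metric space; $\omega$ is the set of natural numbers. A bornology $\mathfrak{B}$ on $X$ is a family of subsets of $X$ that is closed under subsets and finite unions and covers $X$. A base of $\mathfrak{B}$ is a subfamily $\mathfrak{B}_0\subseteq\mathfrak{B}$ such that every $B\in\mathfrak{B}$ is contained in some $B_0\in\mathfrak{B}_0$; it is a closed base if its members are closed. For $B\in\mathfrak{B}$, $\delta>0$: $B^\delta=\bigcup_{x\in B}\{y\in X:d(x,y)<\delta\}$. An ideal on $\omega$ is a family $\mathcal{I}\subseteq\mathcal{P}(\omega)$ closed under subsets and finite unions, containing all finite sets, with $\omega\notin\mathcal{I}$. A set $A\subseteq\omega$ is a pseudounion of $\mathcal{I}$ if $\omega\setminus A$ is infinite and $I\setminus A$ is finite for every $I\in\mathcal{I}$. Covers of $X$ never contain $X$ as an element. An open cover $\{U_n:n\in\omega\}$ (with its enumeration) is a $\gamma_{\mathfrak{B}^s}$-cover if it is infinite and for each $B\in\mathfrak{B}$ there are $n_0\in\omega$ and positive reals $\delta_n$ ($n\geq n_0$) with $B^{\delta_n}\subseteq U_n$ for all $n\geq n_0$. A countable open cover $\{U_n:n\in\omega\}$ (with its enumeration) is an $\mathcal{I}$-$\gamma_{\mathfrak{B}^s}$-cover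 if for each $B\in\mathfrak{B}$ there is a sequence $\{\delta_n\}$ of positive reals with $\{n\in\omega:B^{\delta_n}\nsubseteq U_n\}\in\mathcal{I}$. *)

(* Defs.v *)
From mathcomp Require Import all_boot all_order all_algebra.
From mathcomp Require Import boolp classical_sets functions cardinality reals.
From mathcomp Require Import topology.

Set Implicit Arguments.
Unset Strict Implicit.
Unset Printing Implicit Defensive.

Import Order.TTheory GRing.Theory Num.Theory.

Local Open Scope classical_set_scope.
Local Open Scope ring_scope.

(* Finite unions are given by binary ones; the empty union needs no clause, as
   set0 is a subset of every member of the family. *)
Definition bornology (X : Type) (B : set_system X) : Prop :=
  [/\ forall A C : set X, A `<=` C -> B C -> B A,
      setU_closed B &
      \bigcup_(A in B) A = setT].

Definition bornology_base (X : Type) (B B0 : set_system X) : Prop :=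
  B0 `<=` B /\ forall A, B A -> exists2 A0, B0 A0 & A `<=` A0.

Definition has_closed_base (X : topologicalType) (B : set_system X) : Prop :=
  exists2 B0, bornology_base B B0 & forall A, B0 A -> closed A.

Definition enlargement (R : realType) (X : metricType R) (A : set X)
    (delta : R) : set X :=
  \bigcup_(x in A) [set y | mdist x y < delta].

Definition ideal_omega (I : set_system nat) : Prop :=
  [/\ forall A C : set nat, A `<=` C -> I C -> I A,
      setU_closed I,
      forall A, finite_set A -> I A &
      ~ I setT].

Definition pseudounion (I : set_system nat) (A : set nat) : Prop :=
  infinite_set (~` A) /\ forall C, I C -> finite_set (C `\` A).

(* A countable cover together with its enumeration, repetitions allowed; the
   underlying family of sets is [range U]. *)
Definition open_cover (X : topologicalType) (U : nat -> set X) : Prop :=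
  [/\ forall n, open (U n),
      forall n, U n <> setT &
      \bigcup_n U n = setT].

Definition gamma_cover (R : realType) (X : metricType R) (B : set_system X)
    (U : nat -> set X) : Prop :=
  [/\ open_cover U,
      infinite_set (range U) &
      forall A, B A -> exists (n0 : nat) (delta : nat -> R),
        forall n, (n0 <= n)%N ->
          0 < delta n /\ enlargement A (delta n) `<=` U n].

Definition ideal_gamma_cover (R : realType) (X : metricType R)
    (I : set_system nat) (B : set_system X) (U : nat -> set X) : Prop :=
  open_cover U /\
  forall A, B A -> exists2 delta : nat -> R,
    (forall n, 0 < delta n) &
    I [set n | ~ (enlargement A (delta n) `<=` U n)].

(* Main.v *)
Require Import Defs.
From mathcomp Require Import all_boot all_order all_algebra.
From mathcomp Require Import boolp classical_sets functions cardinality reals.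
From mathcomp Require Import topology.

(** Enumerate injectively, by [e], the complement of a pseudounion [A] of the
    ideal, and keep only the sets [U (e n)] of the cover.  Call the members of
    the bornology bounded.  For a bounded set [C] the indices [k] where the
    inclusion of an enlargement of [C] in [U k] fails form a member of the
    ideal, so all but finitely many of them lie in [A]; as [e] avoids [A] and
    is injective, the inclusion holds at [e n] for all large [n] ([pseudounion_eventually]).

    What remains is that [V n = U (e n)] is an infinite cover.  It covers [X]
    because singletons are bounded.  It is infinite because finite sets are
    bounded too ([bornology_finite]): if the [V n] took finitely many values,
    then choosing a point outside each value, all values being different from
    [X], would give a finite set contained in no [V n], whereas every bounded
    set lies in [V n] for all large [n] ([infinite_range_of_sub_finite]). *)

Local Open Scope classical_set_scope.

Lemma finite_set_nat_bound (C : set nat) :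
  finite_set C -> exists n0, forall n, (n0 <= n)%N -> ~ C n.
Proof.
move=> /finite_seqP[s ->]; exists (\max_(i <- s) i).+1 => n lt_max_n /= n_s.
have le_n_max : (n <= \max_(i <- s) i)%N := leq_bigmax_seq (F := id) n n_s isT.
by rewrite leqNgt lt_max_n in le_n_max.
Qed.

(** [C `\` A] is finite, so [e], being injective, meets it at finitely many
    indices only, and avoiding [A] it meets [C] nowhere else. *)
Lemma pseudounion_eventually (I : set_system nat) (A : set nat)
    (e : nat -> nat) :
  pseudounion I A -> injective e -> (forall n, ~ A (e n)) ->
  forall C, I C -> exists n0, forall n, (n0 <= n)%N -> ~ C (e n).
Proof.
move=> [_ finIA] e_inj eA C /finIA finC.
have /finite_set_nat_bound[n0 n0P] : finite_set (e @^-1` (C `\` A)).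
  by apply: finite_preimage finC => x y _ _; apply: e_inj.
by exists n0 => n le_n0_n Cen; apply: (n0P n le_n0_n).
Qed.

Lemma pseudounion_enum (I : set_system nat) (A : set nat) :
  pseudounion I A ->
  exists2 e : nat -> nat, injective e & forall n, ~ A (e n).
Proof.
move=> [/infiniteP/pcard_leP/injfunPex[e eA e_inj] _].
exists e => [x y|n]; last exact: eA.
by apply: e_inj; rewrite inE.
Qed.

Lemma bornology_set1 (X : Type) (B : set_system X) (x : X) :
  bornology B -> B [set x].
Proof.
move=> [Bsub _ Bcov]; have : [set: X] x by [].
by rewrite -Bcov => -[C BC Cx]; apply: Bsub BC => _ ->.
Qed.

(** The nonemptiness of [X] is needed for the empty set: the empty family is
    a bornology on the empty space. *)
Lemma bornology_finite (X : eqType) (B : set_system X) (x0 : X)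
    (F : set X) : bornology B -> finite_set F -> B F.
Proof.
move=> Bb /finite_seqP[s ->]; have [Bsub BU _] := Bb.
elim: s => [|x s IHs].
  by apply: Bsub (bornology_set1 _ _ x0 Bb) => x /=; rewrite in_nil.
have -> : [set` x :: s] = [set x] `|` [set` s].
  apply/seteqP; split=> y /=; rewrite inE.
    by move=> /orP[/eqP|]; [left|right].
  by case=> [->|ys]; apply/orP; [left|right].
by apply: BU IHs; apply: bornology_set1.
Qed.

(** One point outside each value of [V] gives a set which no [V n] contains;
    it would be finite if [V] took finitely many values. *)
Lemma infinite_range_of_sub_finite (X : Type) (V : nat -> set X) :
  (forall n, V n <> setT) ->
  (forall F, finite_set F -> exists n, F `<=` V n) ->
  infinite_set (range V).
Proof.
move=> VT Vfin finV.
have /choice[p pV] : forall W : set X, exists x, W <> setT -> ~ W x.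
  move=> W; have [->|/eqP/setTPn[x Wx]] := pselect (W = setT); last by exists x.
  (* any point serves for [setT]; [X] has one because [V 0] is not [setT] *)
  by have /eqP/setTPn[x _] := VT 0%N; exists x.
have [n pVn] := Vfin _ (@finite_image _ _ _ p finV).
by apply: (pV (V n) (VT n)); apply: pVn; exists (V n) => //; exists n.
Qed.

Lemma sub_enlargement (R : realType) (X : metricType R) (C : set X)
    (delta : R) : (0 < delta)%R -> C `<=` enlargement C delta.
Proof. by move=> delta_gt0 x Cx; exists x => //=; rewrite mdistxx. Qed.

Theorem lemma3p4 (R : realType) (X : metricType R)
    (X_infinite : infinite_set [set: X])
    (B : set_system X) (B_bornology : bornology B)
    (B_closed_base : has_closed_base B)
    (I : set_system nat) (I_ideal : ideal_omega I)
    (I_pseudounion : exists A : set nat, pseudounion I A)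
    (U : nat -> set X) (U_cover : ideal_gamma_cover I B U) :
  exists V : nat -> set X, range V `<=` range U /\ gamma_cover B V.
Proof.
have [A IA] := I_pseudounion.
have [e e_inj eA] := pseudounion_enum _ _ IA.
have [[Uopen UT _] UI] := U_cover.
exists (U \o e); split; first by move=> _ [n _ <-]; exists (e n).
have gammaV C : B C -> exists (n0 : nat) (delta : nat -> R),
    forall n, (n0 <= n)%N ->
      (0 < delta n)%R /\ enlargement C (delta n) `<=` (U \o e) n.
  move=> /UI[delta delta_gt0 /(pseudounion_eventually _ _ _ IA e_inj eA)[n0 n0P]].
  by exists n0, (delta \o e) => n /n0P/contrapT ?; split=> //=.
have subV C : B C -> exists n, C `<=` (U \o e) n.
  move=> /gammaV[n0 [delta deltaP]]; exists n0.
  have [delta_gt0] := deltaP n0 (leqnn n0).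
  by apply: subset_trans; apply: sub_enlargement.
have [x0 _] := infinite_setN0 X_infinite.
split => //.
  split=> [n|n|]; [exact: Uopen|exact: UT|].
  rewrite -subTset => x _.
  have [n Vx] := subV _ (bornology_set1 _ _ x B_bornology).
  by exists n => //; apply: Vx.
apply: infinite_range_of_sub_finite => [n|F finF]; first exact: UT.
by apply: subV; apply: (bornology_finite _ _ x0).
Qed.
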